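(* Let $(X,\tau)$ be a hyperconnected topological space with $X$ finite and $card(X)\in[m,n]$. Suppose $X=O_1\cup O_2$, where $O_1,O_2\in\tau\setminus\{\emptyset\}$ are nonempty open sets with $card(O_1)\in[a_1,a_2]$ and $card(O_2)\in[b_1,b_2]$. Then $card(O_1\cap O_2)\in[a_1+b_1-n,\;a_2+b_2-m]\cap\mathbb{N}_0$.
   Context: $card(S)$ denotes the number of elements of a finite set $S$. For real numbers $a_1\le a_2$, $[a_1,a_2]=\{x\in\mathbb{R}: a_1\le x\le a_2\}$; such intervals serve as estimates for cardinalities that are not known exactly, and $\mathbb{N}_0=\mathbb{N}\cup\{0\}$. A topological space $(X,\tau)$ is hyperconnected if $cl(O)=X$ for every $O\in\tau\setminus\{\emptyset\}$, where $cl$ denotes closure. *)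

(* Defs.v *)
From HB Require Import structures.
From mathcomp Require Import all_boot all_order all_algebra finmap.
From mathcomp Require Import boolp classical_sets functions cardinality.
From mathcomp Require Import set_interval reals topology.

Set Implicit Arguments.
Unset Strict Implicit.
Unset Printing Implicit Defensive.

Import Order.TTheory GRing.Theory Num.Theory.

Local Open Scope classical_set_scope.

Definition hyperconnected (X : topologicalType) : Prop :=
  forall O : set X, open O -> O !=set0 -> closure O = [set: X].

(* [fset_set A] is empty when [A] is infinite: [set_card A] is meaningful only for
   finite [A]. *)
Definition set_card (T : choiceType) (A : set T) : nat := #|` fset_set A|.

(* Main.v *)
Require Import Defs.
From mathcomp Require Import all_boot all_order all_algebra finmap.
From mathcomp Require Import boolp classical_sets functions cardinality.
From mathcomp Require Import set_interval reals topology.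
From mathcomp Require Import lra.

Import Order.TTheory GRing.Theory Num.Theory.
Local Open Scope classical_set_scope.
Local Open Scope ring_scope.

(** Inclusion-exclusion ([set_cardUI]), with the union being all of X, makes card(O1 ∩ O2) equal to
    card(O1) + card(O2) - card(X). Interval arithmetic then bounds it: the lower end pairs the lower
    estimates of O1 and O2 with the upper estimate [n] of X, and the upper end pairs their upper
    estimates with [m]. *)

Lemma set_cardUI (T : choiceType) (A B : set T) :
  finite_set A -> finite_set B ->
  (set_card (A `|` B) + set_card (A `&` B) = set_card A + set_card B)%N.
Proof.
(* Finiteness of both sets is what lets [fset_set] commute with union and intersection. *)
by move=> finA finB; rewrite /set_card fset_setU // fset_setI ?cardfsUI.
Qed.

Theorem theorem3p5 (R : realType) (X : topologicalType)
    (m n a1 a2 b1 b2 : R) (O1 O2 : set X)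
    (hX : hyperconnected X) (finX : finite_set [set: X])
    (hmn : m <= n) (ha : a1 <= a2) (hb : b1 <= b2)
    (cardX : (set_card [set: X])%:R \in `[m, n]%classic)
    (XE : [set: X] = O1 `|` O2)
    (openO1 : open O1) (O1_neq0 : O1 !=set0)
    (openO2 : open O2) (O2_neq0 : O2 !=set0)
    (cardO1 : (set_card O1)%:R \in `[a1, a2]%classic)
    (cardO2 : (set_card O2)%:R \in `[b1, b2]%classic) :
  (set_card (O1 `&` O2))%:R \in
    `[a1 + b1 - n, a2 + b2 - m]%classic `&` [set x : R | x \is a Num.nat].
Proof.
have sub A : finite_set (A : set X) by exact: sub_finite_set finX.
have := set_cardUI _ _ _ (sub O1) (sub O2); rewrite -XE.
(* The additive identity is cast to [R] before anything is subtracted, so truncated subtraction on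
   naturals never enters. *)
move=> /(congr1 (fun k => k%:R : R)); rewrite !natrD => cardE.
move: cardX cardO1 cardO2; rewrite !inE /= !in_itv /=.
move=> /andP[mX Xn] /andP[a1O O1a] /andP[b1O O2b].
(* Membership in ℕ₀ is immediate, the value being the cast of a natural number. *)
split; last exact: natr_nat.
by apply/andP; split; lra.
Qed.
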